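(* Let $n\geq 1$ be an integer and let $-\frac{\pi}{2}<\alpha<\frac{\pi}{2}$. If $p\in\mathcal{H}[1,n]$ satisfies $p(z)\neq0$ for all $z\in\mathbb{U}$, $p\not\equiv1$, and $$\left|p(z)+\frac{zp'(z)}{p(z)}-1\right|<\left(\frac{n}{2}+1\right)|p(z)|\cos\alpha\qquad(z\in\mathbb{U}),$$ then $$|\arg(p(z))|<\frac{\pi}{2}-|\alpha|\qquad(z\in\mathbb{U}).$$
   Context: $\mathbb{U}=\{z\in\mathbb{C}:|z|<1\}$ is the open unit disk. For an integer $n\geq1$ and $a_0\in\mathbb{C}$, $\mathcal{H}[a_0,n]$ denotes the class of functions $p(z)=a_0+\sum_{k=n}^{\infty}a_kz^k$ analytic in $\mathbb{U}$. Here $\arg$ is the principal argument. *)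

(* Defs.v *)
From Stdlib Require Import Reals Lra.
From Coquelicot Require Import Coquelicot.
Local Open Scope R_scope.

Definition in_unit_disk (z : C) : Prop := Cmod z < 1.

(* Complex differentiability at every point of the open disk; the values of
   [f] outside the disk are irrelevant. *)
Definition analytic_in_disk (f : C -> C) : Prop :=
  forall z : C, in_unit_disk z ->
    ex_derive (K := C_AbsRing) (V := C_NormedModule) f z.

(* The class H[a0, n]. For n = 0 the condition on the coefficients would be
   just [a 0 = a0]; the class is only used for n >= 1. *)
Definition class_H (a0 : C) (n : nat) (p : C -> C) : Prop :=
  analytic_in_disk p /\
  exists a : nat -> C,
    a O = a0 /\
    (forall k : nat, (0 < k < n)%nat -> a k = RtoC 0) /\
    (forall z : C, in_unit_disk z ->
       is_pseries (K := C_AbsRing) (V := C_NormedModule) a z (p z)).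

(* Principal argument, with values in (-PI, PI]; the value at 0 is junk.
   [acos] takes values in [0, PI], so the sign of [Im z] picks the branch. *)
Definition Arg (z : C) : R :=
  if Rlt_dec (Im z) 0 then - acos (Re z / Cmod z) else acos (Re z / Cmod z).

Lemma Arg_spec (z : C) : z <> RtoC 0 ->
  - PI < Arg z <= PI /\
  z = (RtoC (Cmod z) * (cos (Arg z), sin (Arg z)))%C.
Proof.
intros Hz.
assert (Hm : 0 < Cmod z) by now apply Cmod_gt_0.
assert (H2 : Cmod z * Cmod z = Re z * Re z + Im z * Im z).
{ generalize (Cmod2_alt z); simpl; intros H; lra. }
set (c := Re z / Cmod z); set (s := Im z / Cmod z).
assert (Hre : Re z = Cmod z * c) by (unfold c; field; lra).
assert (Him : Im z = Cmod z * s) by (unfold s; field; lra).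
assert (Hcs : c * c + s * s = 1).
{ unfold c, s.
  replace (_ + _) with ((Re z * Re z + Im z * Im z) / (Cmod z * Cmod z))
    by (field; lra).
  rewrite <- H2; field; lra. }
assert (Hc : -1 <= c <= 1) by nra.
assert (Hs : 1 - Rsqr c = Rsqr s) by (unfold Rsqr; lra).
assert (E : forall t, cos t = c -> sin t = s ->
  z = (RtoC (Cmod z) * (cos t, sin t))%C).
{ intros t -> ->. rewrite (surjective_pairing z) at 1.
  unfold Cmult, RtoC; simpl. fold (Re z) (Im z). f_equal; lra. }
generalize (acos_bound c) PI_RGT_0; intros Hb Hpi.
unfold Arg; fold c.
destruct (Rlt_dec (Im z) 0) as [Hi|Hi].
- assert (Hs0 : s < 0) by nra.
  assert (acos c <> PI).
  { intros Ha. assert (c = -1).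
    { rewrite <- (cos_acos c Hc), Ha. apply cos_PI. } nra. }
  split; [lra|]. apply E.
  + now rewrite cos_neg, cos_acos.
  + rewrite sin_neg, (sin_acos c Hc), Hs, sqrt_Rsqr_abs, Rabs_left; lra.
- assert (Hs0 : 0 <= s) by nra.
  split; [lra|]. apply E.
  + now apply cos_acos.
  + rewrite (sin_acos c Hc), Hs. now apply sqrt_Rsqr.
Qed.

(* Main.v *)
Require Import Defs.
From Stdlib Require Import Reals Lra Lia List Classical IndefiniteDescription.
From Coquelicot Require Import Coquelicot.
Local Open Scope R_scope.

(** Write [c = cos alpha].  Since [p = 1 + z^n P] has no zero, its reciprocal is
    [1/p = 1 + z^n F] with [F = - P/p] holomorphic in the disk, and differentiating
    [p (1 + z^n F) = 1] gives
    [p + z p'/p - 1 = - p z^n ((n + 1) F + z F')]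
    ([log_derivative_of_reciprocal]).  So the hypothesis reads
    [|z^n ((n + 1) F + z F')| < (n/2 + 1) c].

    It is enough to prove [|1 - p| < c |p|], i.e. [|z^n F| < c]: then [1/p] lies in the
    disk of centre 1 and radius [cos alpha], which is contained in the open sector of
    half-angle [PI/2 - |alpha|] ([Arg_lt_of_close_to_1]).

    Suppose [|z1^n F(z1)| >= c] and let [r = |z1|].  As in Jack's lemma, look at the point
    [z0] of the closed disk of radius [r] where [|F|] is largest.  By the maximum principle
    it may be taken on the circle, and there the radial derivative of [|F|] is nonnegative,
    which forces [|(n + 1) F + z F'| >= (n + 1) |F|], hence
    [|z0^n ((n + 1) F + z0 F')| >= (n + 1) c >= (n/2 + 1) c], a contradiction.

    To have a maximum principle by elementary means, [|F| + eps |z|^2] is maximised instead.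
    It has no local maximum in the open disk ([no_local_max]): averaging a third-order
    expansion of [F] over the four points [z0 + s], [z0 - s], [z0 + is], [z0 - is] kills the
    terms of degree 1 and 2, whereas the average of [|z|^2] grows by [s^2].  The penalty
    costs at most [2 eps r^2] in the boundary estimate ([radial_derivative_at_max]), and
    [n + 1 - 1/2 >= n/2 + 1] leaves room for it when [eps = c/4].

    The expansions of [F] come from those of power series by algebra.  A power series on
    the disk, divided by [z - z0] after subtraction of its value at [z0], is again a power
    series on the disk ([power_series_divided_difference]), so it can be expanded to any
    order at [z0]; and functions with an expansion of given order are closed under products
    and reciprocals ([expandable_mult], [expandable_inv]). *)

(** * Sums of complex series *)

Definition has_sum (u : nat -> C) (l : C) : Prop :=
  is_series (K := C_AbsRing) (V := C_NormedModule) u l.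

Lemma is_pseries_has_sum (a : nat -> C) (z l : C) :
  is_pseries (K := C_AbsRing) (V := C_NormedModule) a z l <->
  has_sum (fun k => z ^ k * a k)%C l.
Proof.
assert (E : forall k, pow_n (K := C_Ring) z k = (z ^ k)%C).
{ induction k as [|k IH]; [reflexivity|]. rewrite Cpow_S, <- IH. reflexivity. }
split; apply is_series_ext; intros k; [|symmetry];
  change (mult (pow_n (K := C_Ring) z k) (a k) = (z ^ k * a k)%C); rewrite E; reflexivity.
Qed.

Lemma has_sum_unique (u : nat -> C) (l l' : C) : has_sum u l -> has_sum u l' -> l = l'.
Proof.
exact (filterlim_locally_unique (K := C_AbsRing) (V := C_NormedModule) _ l l').
Qed.

Lemma has_sum_ext (u v : nat -> C) (l : C) :
  (forall k, u k = v k) -> has_sum u l -> has_sum v l.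
Proof. exact (is_series_ext (K := C_AbsRing) (V := C_NormedModule) u v l). Qed.

Lemma has_sum_shift (u : nat -> C) (l : C) :
  has_sum u l -> has_sum (fun k => u (S k)) (l - u 0%nat)%C.
Proof.
intros H. apply (is_series_incr_1 (K := C_AbsRing) (V := C_NormedModule)).
replace (plus _ _) with l; [exact H|].
change (l = l - u 0%nat + u 0%nat)%C. ring.
Qed.

Lemma has_sum_lincomb (u v : nat -> C) (l m c d : C) :
  has_sum u l -> has_sum v m -> has_sum (fun k => c * u k + d * v k)%C (c * l + d * m)%C.
Proof.
intros Hu Hv.
apply (is_series_plus (K := C_AbsRing) (V := C_NormedModule)
  (fun k => c * u k)%C (fun k => d * v k)%C).
- exact (is_series_scal (K := C_AbsRing) (V := C_NormedModule) c u l Hu).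
- exact (is_series_scal (K := C_AbsRing) (V := C_NormedModule) d v m Hv).
Qed.

Lemma has_sum_terms_bounded (u : nat -> C) (l : C) :
  has_sum u l -> exists M, forall k, Cmod (u k) <= M.
Proof.
intros H.
destruct (filterlim_bounded (K := C_AbsRing) (V := C_NormedModule)
  (sum_n (G := C_AbelianMonoid) u))
  as [M HM]; [eexists; exact H|].
change (forall k, Cmod (sum_n (G := C_AbelianMonoid) u k) <= M) in HM.
exists (2 * M). intros k.
assert (H0 := HM 0%nat). generalize (Cmod_ge_0 (sum_n (G := C_AbelianMonoid) u 0%nat)). intros H0'.
destruct k as [|k].
- rewrite sum_O in *. lra.
- assert (Hk := HM k). assert (HS := HM (S k)).
  rewrite sum_Sn in HS.
  set (s := sum_n u k) in *. change (plus s (u (S k))) with (s + u (S k))%C in HS.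
  replace (u (S k)) with ((s + u (S k)) + - s)%C by ring.
  eapply Rle_trans; [apply Cmod_triangle|]. rewrite Cmod_opp. lra.
Qed.

Lemma has_sum_geometric_domination (u : nat -> C) (K q : R) :
  0 <= q < 1 -> (forall k, Cmod (u k) <= K * q ^ k) ->
  exists l : C, has_sum u l /\ Cmod l <= K / (1 - q).
Proof.
intros Hq Hu.
assert (HK : 0 <= K).
{ generalize (Hu 0%nat) (Cmod_ge_0 (u 0%nat)); simpl; lra. }
assert (Hg : is_series (fun k => K * q ^ k) (K * / (1 - q))).
{ apply (is_series_scal (K := R_AbsRing) (V := R_NormedModule) K).
  apply is_series_geom. rewrite Rabs_pos_eq; lra. }
destruct (ex_series_le (K := C_AbsRing) (V := C_CompleteNormedModule) u
            (fun k => K * q ^ k)) as [l Hl].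
- intros k. apply Hu.
- eexists; exact Hg.
- exists l. split; [exact Hl|].
  assert (Hn : is_lim_seq (fun N => Cmod (sum_n (G := C_AbelianMonoid) u N)) (Cmod l)).
  { apply (filterlim_comp _ _ _ _ (fun z : C => Cmod z) _ _ _ Hl).
    exact (filterlim_norm (K := C_AbsRing) (V := C_NormedModule) l). }
  assert (Hm : is_lim_seq (sum_n (fun k => K * q ^ k)) (K / (1 - q))) by exact Hg.
  refine (is_lim_seq_le _ _ (Finite (Cmod l)) (Finite (K / (1 - q))) _ Hn Hm).
  intros N.
  induction N as [|N IH].
  + rewrite !sum_O. apply Hu.
  + rewrite !sum_Sn. eapply Rle_trans; [apply Cmod_triangle|].
    apply Rplus_le_compat; [exact IH|apply Hu].
Qed.

(** * Power series on the unit disk *)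

Definition is_power_series (a : nat -> C) (f : C -> C) : Prop :=
  forall z, in_unit_disk z -> has_sum (fun k => z ^ k * a k)%C (f z).

(** The growth of coefficients that characterises convergence on the whole disk; unlike
    convergence it passes at once to sequences dominated termwise. *)
Definition subgeometric (a : nat -> C) : Prop :=
  forall r, 0 < r < 1 -> exists K, forall k, Cmod (a k) * r ^ k <= K.

Lemma power_series_subgeometric a f : is_power_series a f -> subgeometric a.
Proof.
intros Hf r Hr.
assert (Hd : in_unit_disk (RtoC r)).
{ unfold in_unit_disk. rewrite Cmod_R, Rabs_pos_eq; lra. }
destruct (has_sum_terms_bounded _ _ (Hf _ Hd)) as [M HM].
exists M. intros k. generalize (HM k).
rewrite Cmod_mult, Cmod_pow, Cmod_R, Rabs_pos_eq by lra. lra.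
Qed.

(** One geometric series dominates all the tails at once, so the bound is uniform in [z]
    and in [n].  The uniformity in [n] makes the coefficients of a divided difference
    subgeometric; the uniformity in [z] makes a power series locally bounded. *)
Lemma subgeometric_tail_sums a s r : subgeometric a -> 0 <= s < r -> r < 1 ->
  exists K, forall z n, Cmod z <= s -> exists l,
    has_sum (fun j => z ^ j * a (n + j)%nat)%C l /\ Cmod l * r ^ n <= K.
Proof.
intros Ha Hs Hr.
destruct (Ha r) as [K HK]; [lra|].
assert (Hq : 0 <= s / r < 1).
{ split; [apply Rle_mult_inv_pos; lra|]. apply Rlt_div_l; lra. }
exists (K / (1 - s / r)).
intros z n Hz.
assert (Hrn : 0 < r ^ n) by (apply pow_lt; lra).
destruct (has_sum_geometric_domination (fun j => z ^ j * a (n + j)%nat)%C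
            (K / r ^ n) (s / r) Hq) as [l [Hl Hb]].
- intros j.
  rewrite Cmod_mult, Cmod_pow.
  apply Rle_trans with (s ^ j * Cmod (a (n + j)%nat)).
  { apply Rmult_le_compat_r; [apply Cmod_ge_0|].
    apply pow_incr. split; [apply Cmod_ge_0|exact Hz]. }
  replace (s ^ j) with ((s / r) ^ j * r ^ j).
  2: { rewrite <- Rpow_mult_distr. f_equal. field. lra. }
  assert (Hp : 0 <= (s / r) ^ j) by (apply pow_le; lra).
  replace (K / r ^ n * (s / r) ^ j) with ((s / r) ^ j * (K / r ^ n)) by ring.
  rewrite Rmult_assoc. apply Rmult_le_compat_l; [exact Hp|].
  apply (proj1 (Rle_div_r _ _ _ Hrn)).
  specialize (HK (n + j)%nat). rewrite pow_add in HK. lra.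
- exists l. split; [exact Hl|].
  replace (K / (1 - s / r)) with (K / r ^ n / (1 - s / r) * r ^ n).
  + apply Rmult_le_compat_r; [lra|exact Hb].
  + set (q := s / r) in *. field. lra.
Qed.

Lemma subgeometric_power_series a : subgeometric a -> exists f, is_power_series a f.
Proof.
intros Ha.
apply (functional_choice (fun z l => in_unit_disk z -> has_sum (fun k => z ^ k * a k)%C l)).
intros z. destruct (Rlt_le_dec (Cmod z) 1) as [Hz|Hz].
- destruct (subgeometric_tail_sums a (Cmod z) ((Cmod z + 1) / 2) Ha) as [K HK];
    [generalize (Cmod_ge_0 z); lra|lra|].
  destruct (HK z 0%nat) as [l [Hl _]]; [lra|]. exists l. intros _. exact Hl.
- exists 0%C. unfold in_unit_disk. lra.
Qed.

(** The recursion on the coefficients is synthetic division by [z - z0], and the constant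
    term is the remainder. *)
Lemma power_series_quotient a b f z0 :
  is_power_series a f -> subgeometric b ->
  (forall k, a (S k) = b k - z0 * b (S k))%C ->
  exists g, is_power_series b g /\
    forall z, in_unit_disk z -> f z = (a 0%nat + z0 * b 0%nat + (z - z0) * g z)%C.
Proof.
intros Hf Hb Hab.
destruct (subgeometric_power_series b Hb) as [g Hg].
exists g. split; [exact Hg|]. intros z Hz.
assert (Hf1 := has_sum_shift _ _ (Hf z Hz)).
assert (Hg1 := has_sum_shift _ _ (Hg z Hz)).
assert (H := has_sum_lincomb _ _ _ _ z (- z0) (Hg z Hz) Hg1).
cbv beta in H.
apply (has_sum_ext _ (fun k => z ^ S k * a (S k))%C) in H.
2: { intros k. rewrite Hab, Cpow_S. ring. }
generalize (has_sum_unique _ _ _ Hf1 H). cbn [Cpow]. intros E.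
replace (f z) with (f z - 1 * a 0%nat + a 0%nat)%C by ring.
rewrite E. ring.
Qed.

Lemma power_series_shift a f : is_power_series a f ->
  exists g, is_power_series (fun k => a (S k)) g /\
    forall z, in_unit_disk z -> f z = (a 0%nat + z * g z)%C.
Proof.
intros Hf.
destruct (power_series_quotient a (fun k => a (S k)) f 0 Hf) as [g [Hg E]].
- intros r Hr. destruct (power_series_subgeometric a f Hf r Hr) as [K HK].
  exists (K / r). intros k. apply -> Rle_div_r; [|lra]. specialize (HK (S k)). simpl in HK. lra.
- intros k. ring.
- exists g. split; [exact Hg|]. intros z Hz. rewrite (E z Hz). ring.
Qed.

(** The quotient has coefficients [b k], the sum over [j] of [a (k + 1 + j) z0 ^ j], and
    these tails grow no faster than the coefficients [a] themselves. *)
Lemma power_series_divided_difference a f z0 : is_power_series a f -> in_unit_disk z0 ->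
  exists b g, is_power_series b g /\
    forall z, in_unit_disk z -> f z = (f z0 + (z - z0) * g z)%C.
Proof.
intros Hf Hz0.
assert (Ha := power_series_subgeometric a f Hf).
assert (Hz0' : 0 <= Cmod z0 < 1) by (split; [apply Cmod_ge_0|exact Hz0]).
destruct (functional_choice (fun k l => has_sum (fun j => z0 ^ j * a (S k + j)%nat)%C l)) as [b Hb].
{ intros k. destruct (subgeometric_tail_sums a (Cmod z0) ((Cmod z0 + 1) / 2) Ha) as [K HK];
    [lra|lra|].
  destruct (HK z0 (S k)) as [l [Hl _]]; [lra|]. now exists l. }
destruct (power_series_quotient a b f z0 Hf) as [g [Hg E]].
- intros r Hr.
  (* The tails at [z0] are controlled only on radii larger than [Cmod z0]. *)
  set (s := Rmax r ((Cmod z0 + 1) / 2)).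
  assert (Hs : r <= s /\ Cmod z0 < s < 1).
  { unfold s, Rmax. destruct Rle_dec; lra. }
  destruct (subgeometric_tail_sums a (Cmod z0) s Ha) as [K HK]; [lra|lra|].
  exists (K / s). intros k. apply -> Rle_div_r; [|lra].
  destruct (HK z0 (S k)) as [l [Hl Hb']]; [lra|].
  rewrite <- (has_sum_unique _ _ _ (Hb k) Hl) in Hb'.
  eapply Rle_trans; [|exact Hb'].
  replace (Cmod (b k) * r ^ k * s) with (Cmod (b k) * (s * r ^ k)) by ring.
  apply Rmult_le_compat_l; [apply Cmod_ge_0|].
  apply (Rmult_le_compat_l s); [lra|]. apply pow_incr. lra.
- intros k. assert (H := has_sum_shift _ _ (Hb k)).
  assert (H' := has_sum_lincomb _ _ _ _ z0 0 (Hb (S k)) (Hb (S k))).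
  apply (has_sum_ext _ (fun j => z0 ^ S j * a (S k + S j)%nat)%C) in H'.
  2: { intros j. rewrite Cpow_S. replace (S (S k) + j)%nat with (S k + S j)%nat by lia. ring. }
  generalize (has_sum_unique _ _ _ H H').
  replace (S k + 0)%nat with (S k) by lia. cbn [Cpow]. intros E.
  replace (a (S k)) with (b k - (b k - 1 * a (S k)))%C by ring. rewrite E. ring.
- exists b, g. split; [exact Hg|]. intros z Hz.
  rewrite (E z Hz), (E z0 Hz0). ring.
Qed.

(** * Local expansions *)

(** Balls for [Cmod] are used in place of [locally], whose balls for the product
    structure of [C] are squares. *)
Definition near (z0 : C) (P : C -> Prop) : Prop :=
  exists d, 0 < d /\ forall z, Cmod (z - z0) < d -> P z.

Lemma near_here z0 P : near z0 P -> P z0.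
Proof.
intros [d [Hd H]]. apply H. replace (z0 - z0)%C with (RtoC 0) by ring. now rewrite Cmod_0.
Qed.

Lemma near_mono z0 (P Q : C -> Prop) : (forall z, P z -> Q z) -> near z0 P -> near z0 Q.
Proof. intros HPQ [d [Hd H]]. exists d. auto. Qed.

Lemma near_and z0 (P Q : C -> Prop) : near z0 P -> near z0 Q -> near z0 (fun z => P z /\ Q z).
Proof.
intros [d [Hd H]] [e [He H']]. exists (Rmin d e). split; [now apply Rmin_pos|].
intros z Hz. split.
- apply H. eapply Rlt_le_trans; [exact Hz|apply Rmin_l].
- apply H'. eapply Rlt_le_trans; [exact Hz|apply Rmin_r].
Qed.

Lemma near_ball z0 r : 0 < r -> near z0 (fun z => Cmod (z - z0) < r).
Proof. intros Hr. exists r. auto. Qed.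

Lemma near_unit_disk z0 : in_unit_disk z0 -> near z0 in_unit_disk.
Proof.
intros Hz0. unfold in_unit_disk in *. exists (1 - Cmod z0). split; [lra|].
intros z Hz. replace z with ((z - z0) + z0)%C by ring.
generalize (Cmod_triangle (z - z0) z0). lra.
Qed.

(** [f] has an expansion of order [k] at [z0] with a remainder of size [(z - z0) ^ k].
    The nested form, one divided difference per degree, makes the closure properties
    immediate inductions without any bookkeeping of remainders. *)
Fixpoint expandable (k : nat) (z0 : C) (f : C -> C) : Prop :=
  match k with
  | O => exists K, near z0 (fun z => Cmod (f z) <= K)
  | S k => exists g, expandable k z0 g /\ near z0 (fun z => f z = f z0 + (z - z0) * g z)%C
  end.

Lemma expandable_pred k : forall z0 f, expandable (S k) z0 f -> expandable k z0 f.
Proof.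
induction k as [|k IH]; intros z0 f [g [Hg H]].
- destruct Hg as [K HK]. exists (Cmod (f z0) + K).
  eapply near_mono; [|exact (near_and _ _ _ (near_and _ _ _ H HK) (near_ball z0 1 Rlt_0_1))].
  intros z [[E Hz] Hz1]. rewrite E. eapply Rle_trans; [apply Cmod_triangle|].
  rewrite Cmod_mult. generalize (Cmod_ge_0 (z - z0)) (Cmod_ge_0 (g z)). nra.
- exists g. split; [now apply IH|exact H].
Qed.

Lemma expandable_const k z0 c : expandable k z0 (fun _ => c).
Proof.
revert c; induction k as [|k IH]; intros c.
- exists (Cmod c), 1. split; [lra|]. intros; lra.
- exists (fun _ => 0%C). split; [apply IH|]. exists 1. split; [lra|]. intros; ring.
Qed.

Lemma expandable_plus k z0 : forall f g,
  expandable k z0 f -> expandable k z0 g -> expandable k z0 (fun z => f z + g z)%C.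
Proof.
induction k as [|k IH]; intros f g.
- intros [K HK] [L HL]. exists (K + L).
  eapply near_mono; [|exact (near_and _ _ _ HK HL)]. cbv beta.
  intros z [H H']. eapply Rle_trans; [apply Cmod_triangle|]. lra.
- intros [f1 [Hf1 Ef]] [g1 [Hg1 Eg]].
  exists (fun z => f1 z + g1 z)%C. split; [now apply IH|].
  eapply near_mono; [|exact (near_and _ _ _ Ef Eg)]. cbv beta.
  intros z [H H']. rewrite H, H'. ring.
Qed.

Lemma expandable_mult k z0 : forall f g,
  expandable k z0 f -> expandable k z0 g -> expandable k z0 (fun z => f z * g z)%C.
Proof.
induction k as [|k IH]; intros f g Hf Hg.
- destruct Hf as [K HK], Hg as [L HL]. exists (K * L).
  eapply near_mono; [|exact (near_and _ _ _ HK HL)]. cbv beta.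
  intros z [H H']. rewrite Cmod_mult. apply Rmult_le_compat; auto using Cmod_ge_0.
- assert (Hg' := expandable_pred _ _ _ Hg).
  destruct Hf as [f1 [Hf1 Ef]], Hg as [g1 [Hg1 Eg]].
  exists (fun z => f1 z * g z + f z0 * g1 z)%C. split.
  + apply expandable_plus; apply IH; auto using expandable_const.
  + eapply near_mono; [|exact (near_and _ _ _ Ef Eg)]. cbv beta.
    intros z [H H']. rewrite H, H'. ring.
Qed.

Lemma expandable_near_neq0 k z0 f : expandable (S k) z0 f -> f z0 <> 0%C ->
  near z0 (fun z => Cmod (f z0) / 2 <= Cmod (f z)).
Proof.
intros Hf H0.
assert (H1 : expandable 1 z0 f).
{ clear H0. induction k as [|k IH]; [exact Hf|]. apply IH, expandable_pred, Hf. }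
destruct H1 as [g [[K HK] E]].
apply Cmod_gt_0 in H0.
set (d := Cmod (f z0) / (2 * (Rabs K + 1))).
assert (HK1 : 0 < 2 * (Rabs K + 1)) by (generalize (Rabs_pos K); lra).
assert (Hd : 0 < d) by now apply Rdiv_lt_0_compat.
eapply near_mono; [|exact (near_and _ _ _ (near_and _ _ _ E HK) (near_ball z0 d Hd))].
intros z [[Ez Hz] Hz1].
assert (Hs : Cmod ((z - z0) * g z) <= Cmod (f z0) / 2).
{ rewrite Cmod_mult.
  replace (Cmod (f z0) / 2) with (d * (Rabs K + 1)).
  2:{ unfold d. field. lra. }
  apply Rmult_le_compat; auto using Cmod_ge_0; [lra|].
  generalize (Rle_abs K). lra. }
generalize (Cmod_triangle (f z) (- ((z - z0) * g z))).
rewrite Cmod_opp. replace (f z + _)%C with (f z0) by (rewrite Ez; ring). lra.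
Qed.

(** The divided difference of [/ f] is [- g / (f z0 * f)] if [g] is that of [f], so an
    expansion of [/ f] gains one order from the previous one. *)
Lemma expandable_inv k z0 f : expandable (S k) z0 f -> f z0 <> 0%C ->
  expandable (S k) z0 (fun z => / f z)%C.
Proof.
intros Hf H0. assert (Hn := expandable_near_neq0 k z0 f Hf H0).
assert (H0' := H0). apply Cmod_gt_0 in H0'.
assert (Hb : expandable 0 z0 (fun z => / f z)%C).
{ exists (2 / Cmod (f z0)). eapply near_mono; [|exact Hn]. cbv beta. intros z Hz.
  rewrite Cmod_inv by (apply Cmod_gt_0; lra).
  replace (2 / Cmod (f z0)) with (/ (Cmod (f z0) / 2)) by (field; lra).
  apply Rinv_le_contravar; lra. }
(* The base is the local boundedness of [/ f], which needs the continuity of [f]; hence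
   the order [S k] in the hypothesis. *)
assert (Hstep : forall m, expandable (S m) z0 f -> expandable m z0 (fun z => / f z)%C ->
  expandable (S m) z0 (fun z => / f z)%C).
{ intros m [g [Hg E]] Hm.
  exists (fun z => (- / f z0) * (g z * / f z))%C. split.
  - apply expandable_mult; [apply expandable_const|]. now apply expandable_mult.
  - eapply near_mono; [|exact (near_and _ _ _ E Hn)]. cbv beta. intros z [Ez Hz].
    assert (Hz0 : f z <> 0%C) by (apply Cmod_gt_0; lra).
    apply (f_equal (fun w => w - f z0)%C) in Ez.
    replace ((z - z0) * (- / f z0 * (g z * / f z)))%C
      with (- (f z0 + (z - z0) * g z - f z0) * / f z0 * / f z)%C by ring.
    rewrite <- Ez. field. auto. }
induction k as [|k IH]; [now apply Hstep|].
apply Hstep; [exact Hf|]. apply expandable_pred in Hf.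
now apply IH.
Qed.

Lemma power_series_expandable k : forall a f z0,
  is_power_series a f -> in_unit_disk z0 -> expandable k z0 f.
Proof.
induction k as [|k IH]; intros a f z0 Hf Hz0.
- assert (Hz0' : 0 <= Cmod z0 < 1) by (split; [apply Cmod_ge_0|exact Hz0]).
  destruct (subgeometric_tail_sums a ((2 * Cmod z0 + 1) / 3) ((Cmod z0 + 2) / 3)
    (power_series_subgeometric a f Hf)) as [K HK]; [lra|lra|].
  exists K. exists ((1 - Cmod z0) / 3). split; [lra|]. intros z Hz.
  assert (Hz1 : Cmod z <= (2 * Cmod z0 + 1) / 3).
  { replace z with ((z - z0) + z0)%C by ring.
    generalize (Cmod_triangle (z - z0) z0). lra. }
  destruct (HK z 0%nat Hz1) as [l [Hl Hb]].
  rewrite (has_sum_unique _ _ _ (Hf z ltac:(unfold in_unit_disk; lra)) Hl).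
  simpl in Hb. lra.
- destruct (power_series_divided_difference a f z0 Hf Hz0) as [b [g [Hg E]]].
  exists g. split; [now apply (IH b)|].
  exact (near_mono _ _ _ E (near_unit_disk z0 Hz0)).
Qed.

Lemma expandable_linear_approx z0 f : expandable 2 z0 f ->
  exists B K, 0 <= K /\
    near z0 (fun z => Cmod (f z - (f z0 + (z - z0) * B)) <= K * Cmod (z - z0) ^ 2)%C.
Proof.
intros [g [[h [[K HK] Eg]] Ef]]. exists (g z0), (Rabs K). split; [apply Rabs_pos|].
eapply near_mono; [|exact (near_and _ _ _ (near_and _ _ _ Ef Eg) HK)].
intros z [[E1 E2] Hz].
replace (f z - (f z0 + (z - z0) * g z0))%C with ((z - z0) ^ 2 * h z)%C
  by (rewrite E1, E2; ring).
rewrite Cmod_mult, Cmod_pow, Rmult_comm.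
apply Rmult_le_compat_r; [apply pow_le, Cmod_ge_0|].
generalize (Rle_abs K). lra.
Qed.

Lemma expandable_quadratic_approx z0 f : expandable 3 z0 f ->
  exists B D K, 0 <= K /\
    near z0 (fun z => Cmod (f z - (f z0 + (z - z0) * B + (z - z0) ^ 2 * D))
                        <= K * Cmod (z - z0) ^ 3)%C.
Proof.
intros [g [[h [[i [[K HK] Eh]] Eg]] Ef]]. exists (g z0), (h z0), (Rabs K). split; [apply Rabs_pos|].
eapply near_mono;
  [|exact (near_and _ _ _ (near_and _ _ _ (near_and _ _ _ Ef Eg) Eh) HK)].
intros z [[[E1 E2] E3] Hz].
replace (f z - (f z0 + (z - z0) * g z0 + (z - z0) ^ 2 * h z0))%C with ((z - z0) ^ 3 * i z)%C
  by (rewrite E1, E2, E3; ring).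
rewrite Cmod_mult, Cmod_pow, Rmult_comm.
apply Rmult_le_compat_r; [apply pow_le, Cmod_ge_0|].
generalize (Rle_abs K). lra.
Qed.

Lemma linear_approx_is_derive (f : C -> C) z0 B K : 0 <= K ->
  near z0 (fun z => Cmod (f z - (f z0 + (z - z0) * B)) <= K * Cmod (z - z0) ^ 2)%C ->
  is_derive (K := C_AbsRing) (V := C_NormedModule) f z0 B.
Proof.
intros HK Hn. split.
- apply is_linear_scal_l.
- intros x Hx.
  assert (E : x = z0).
  { symmetry. apply (is_filter_lim_locally_unique (K := C_AbsRing)
    (V := AbsRing_NormedModule C_AbsRing)).
  exact Hx. }
  subst x. intros eps.
  assert (Hq : 0 < eps / (K + 1)) by (apply Rdiv_lt_0_compat; [apply cond_pos|lra]).
  destruct (near_and _ _ _ Hn (near_ball z0 _ Hq)) as [d [Hd H]].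
  exists (mkposreal d Hd). intros y Hy.
  assert (Hy' : Cmod (y - z0) < d) by exact Hy.
  destruct (H y Hy') as [H1 H2].
  change (Cmod (f y - f z0 - (y - z0) * B) <= eps * Cmod (y - z0))%C.
  replace (f y - f z0 - (y - z0) * B)%C with (f y - (f z0 + (y - z0) * B))%C by ring.
  eapply Rle_trans; [exact H1|]. simpl. rewrite Rmult_1_r, <- Rmult_assoc.
  apply Rmult_le_compat_r; [apply Cmod_ge_0|].
  apply Rlt_div_r in H2; [|lra]. generalize (Cmod_ge_0 (y - z0)). nra.
Qed.

(** * Maxima of the modulus *)

Lemma argmax_list {T} (f : T -> R) (l : list T) x : In x l ->
  exists t, In t l /\ forall u, In u l -> f u <= f t.
Proof.
revert x. induction l as [|y l IH]; intros x Hx; [destruct Hx|].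
destruct l as [|w l'].
- exists y. split; [now left|]. intros u [->|[]]. lra.
- destruct (IH w (or_introl eq_refl)) as [t [Ht H]].
  destruct (Rle_dec (f y) (f t)) as [H'|H'].
  + exists t. split; [now right|]. intros u [->|Hu]; auto.
  + exists y. split; [now left|]. intros u [->|Hu]; [lra|]. specialize (H u Hu). lra.
Qed.

(** If no point were a maximum, every [u] would have a neighbourhood on which [Phi] is
    below its value at some better point [v].  Finitely many neighbourhoods cover the disk,
    and the best of their points [v] lies in one of them: a contradiction. *)
Lemma closed_disk_max (Phi : C -> R) r : 0 <= r ->
  (forall z0, Cmod z0 <= r -> forall eps, 0 < eps -> near z0 (fun z => Phi z < Phi z0 + eps)) ->
  exists z0, Cmod z0 <= r /\ forall z, Cmod z <= r -> Phi z <= Phi z0.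
Proof.
intros Hr Hsc. apply NNPP. intros Hno.
destruct (functional_choice (fun (u : C) (vd : C * posreal) =>
  Cmod (fst vd) <= r /\
  forall z, Cmod (z - u) < 2 * snd vd -> Cmod z <= r -> Phi z < Phi (fst vd))) as [h Hh].
{ intros u. destruct (Rle_lt_dec (Cmod u) r) as [Hu|Hu].
  - destruct (classic (exists v, Cmod v <= r /\ Phi u < Phi v)) as [[v [Hv Huv]]|Hnv].
    + destruct (Hsc u Hu (Phi v - Phi u)) as [d [Hd H]]; [lra|].
      assert (Hd2 : 0 < d / 2) by lra.
      exists (v, mkposreal _ Hd2). simpl. split; [exact Hv|].
      intros z Hz _. specialize (H z ltac:(lra)). lra.
    + exfalso. apply Hno. exists u. split; [exact Hu|].
      intros z Hz. apply Rnot_lt_le. intros Hlt. apply Hnv. now exists z.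
  (* Outside the closed disk, a neighbourhood that misses it will do. *)
  - assert (Hd2 : 0 < (Cmod u - r) / 2) by lra.
    exists (RtoC 0, mkposreal _ Hd2). simpl. rewrite Cmod_0. split; [exact Hr|].
    intros z Hz Hzr. exfalso.
    generalize (Cmod_triangle z (- (z - u))). rewrite Cmod_opp.
    replace (z + - (z - u))%C with u by ring. lra. }
apply (compactness_list 2 (- r, (- r, tt)) (r, (r, tt)) (fun t => snd (h (fst t, fst (snd t))))).
intros [l Hl].
(* The cover is by squares of half-side [d], each inside a ball of radius [2 d]. *)
set (v := fun t : Compactness.Tn 2 R => fst (h (fst t, fst (snd t)))).
assert (Hcov : forall z, Cmod z <= r -> exists t, In t l /\ Phi z < Phi (v t)).
{ intros z Hz. destruct z as [x y].
  generalize (Rmax_Cmod (x, y)). simpl. intros Hm.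
  generalize (Rmax_l (Rabs x) (Rabs y)) (Rmax_r (Rabs x) (Rabs y)). intros Hx Hy.
  destruct (Hl (x, (y, tt))) as [[t1 [t2 []]] [Ht [_ [Hc1 [Hc2 _]]]]].
  { simpl. split; [|split; [|exact I]]; apply Rabs_le_between; lra. }
  exists (t1, (t2, tt)). split; [exact Ht|].
  apply (proj2 (Hh (t1, t2))); [|exact Hz].
  simpl in Hc1, Hc2.
  replace ((x, y) - (t1, t2))%C with (RtoC (x - t1) + Ci * RtoC (y - t2))%C.
  2: { unfold Cminus, Cplus, Cmult, Copp, RtoC, Ci. simpl. f_equal; ring. }
  eapply Rle_lt_trans; [apply Cmod_triangle|].
  rewrite Cmod_mult, Cmod_Ci, !Cmod_R. lra. }
destruct (Hcov 0%C) as [t [Ht _]]; [now rewrite Cmod_0|].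
destruct (argmax_list (fun t => Phi (v t)) l t Ht) as [m [Hm Hmax]].
destruct (Hcov (v m)) as [m' [Hm' Hlt]].
- apply (proj1 (Hh _)).
- specialize (Hmax m' Hm'). lra.
Qed.

Lemma Cmod_sum4_le (a b c d : C) : Cmod (a + b + c + d) <= Cmod a + Cmod b + Cmod c + Cmod d.
Proof.
generalize (Cmod_triangle (a + b + c) d) (Cmod_triangle (a + b) c) (Cmod_triangle a b). lra.
Qed.

(** This replaces the maximum modulus principle.  The increments [s], [- s], [is], [- is]
    have zero sum and their squares have zero sum, so the mean of [F] over the four points
    differs from [F z0] by [O(s^3)], while the mean of [eps |z|^2] exceeds its value at [z0]
    by [eps s^2]. *)
Lemma no_local_max F eps z0 : 0 < eps -> expandable 3 z0 F ->
  ~ near z0 (fun z => Cmod (F z) + eps * Cmod z ^ 2 <= Cmod (F z0) + eps * Cmod z0 ^ 2).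
Proof.
intros Heps HF Hmax.
destruct (expandable_quadratic_approx z0 F HF) as [B [D [K [HK HE]]]].
destruct (near_and _ _ _ Hmax HE) as [d [Hd H]]. clear Hmax HE.
set (s := Rmin (d / 2) (eps / (2 * (K + 1)))).
assert (Hs : 0 < s).
{ apply Rmin_pos; [lra|]. apply Rdiv_lt_0_compat; lra. }
assert (Hsd : s < d).
{ generalize (Rmin_l (d / 2) (eps / (2 * (K + 1)))). fold s. lra. }
assert (HKs : K * s < eps).
{ assert (Hm := Rmin_r (d / 2) (eps / (2 * (K + 1)))). fold s in Hm.
  apply Rle_div_r in Hm; [|lra]. nra. }
set (E := fun h => (F (z0 + h) - (F z0 + h * B + h ^ 2 * D))%C).
assert (Hpt : forall h, Cmod h = s ->
  Cmod (F (z0 + h)%C) + eps * Cmod (z0 + h) ^ 2 <= Cmod (F z0) + eps * Cmod z0 ^ 2 /\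
  Cmod (E h) <= K * s ^ 3).
{ intros h Hh. specialize (H (z0 + h)%C).
  replace (z0 + h - z0)%C with h in H by ring. rewrite Hh in H. apply (H Hsd). }
assert (HsC : Cmod s = s) by (rewrite Cmod_R; apply Rabs_pos_eq; lra).
assert (HiC : Cmod (Ci * s) = s) by (rewrite Cmod_mult, Cmod_Ci, HsC; ring).
destruct (Hpt s HsC) as [A1 R1].
destruct (Hpt (- s)%C ltac:(now rewrite Cmod_opp)) as [A2 R2].
destruct (Hpt (Ci * s)%C HiC) as [A3 R3].
destruct (Hpt (- (Ci * s))%C ltac:(now rewrite Cmod_opp)) as [A4 R4].
assert (Hsq : Cmod (z0 + s) ^ 2 + Cmod (z0 + - s) ^ 2 + Cmod (z0 + Ci * s) ^ 2
   + Cmod (z0 + - (Ci * s)) ^ 2 = 4 * Cmod z0 ^ 2 + 4 * s ^ 2).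
{ rewrite !Cmod2_alt. destruct z0 as [x y]. simpl. ring. }
assert (HCi : (Ci * Ci = - (1))%C).
{ unfold Ci, Cmult, Copp, RtoC. simpl. f_equal; ring. }
assert (Hsum : (4 * F z0 = (F (z0 + s) + F (z0 + - s) + F (z0 + Ci * s) + F (z0 + - (Ci * s)))
   + - (E s + E (- s) + E (Ci * s) + E (- (Ci * s))))%C).
{ unfold E. ring [HCi]. }
assert (H4 : 4 * Cmod (F z0) <= Cmod (F (z0 + s)%C) + Cmod (F (z0 + - s)%C)
  + Cmod (F (z0 + Ci * s)%C) + Cmod (F (z0 + - (Ci * s))%C) + 4 * (K * s ^ 3)).
{ replace (4 * Cmod (F z0)) with (Cmod (4 * F z0)).
  2: { rewrite Cmod_mult, Cmod_R, Rabs_pos_eq; lra. }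
  rewrite Hsum. eapply Rle_trans; [apply Cmod_triangle|]. rewrite Cmod_opp.
  generalize (Cmod_sum4_le (F (z0 + s)) (F (z0 + - s)) (F (z0 + Ci * s)) (F (z0 + - (Ci * s))))%C.
  generalize (Cmod_sum4_le (E s) (E (- s)) (E (Ci * s)) (E (- (Ci * s))))%C. lra. }
assert (s ^ 2 * (K * s) < s ^ 2 * eps).
{ apply Rmult_lt_compat_l; [|exact HKs]. apply pow_lt, Hs. }
assert (Hfin : eps * s ^ 2 <= K * s ^ 3).
{ apply (f_equal (Rmult eps)) in Hsq. lra. }
simpl in *. lra.
Qed.

(** Moving inwards from [z0] to [(1 - t) z0] cannot increase [|F| + eps |z|^2], so
    [|F|] increases by at most [2 eps t |z0|^2].  Since
    [(1 + t c) F(z0) = F((1 - t) z0) + t (c F(z0) + z0 B) + O(t^2)],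
    the triangle inequality gives the bound, after division by [t] and [t -> 0]. *)
Lemma radial_derivative_at_max F B K eps z0 c : 0 <= c -> 0 < eps -> 0 <= K ->
  near z0 (fun z => Cmod (F z - (F z0 + (z - z0) * B)) <= K * Cmod (z - z0) ^ 2)%C ->
  (forall z, Cmod z <= Cmod z0 ->
     Cmod (F z) + eps * Cmod z ^ 2 <= Cmod (F z0) + eps * Cmod z0 ^ 2) ->
  c * Cmod (F z0) - 2 * eps * Cmod z0 ^ 2 <= Cmod (c * F z0 + z0 * B).
Proof.
intros Hc Heps HK [d [Hd HE]] Hmax.
set (X := Cmod (c * F z0 + z0 * B)). set (f0 := Cmod (F z0)) in *. set (rho := Cmod z0) in *.
assert (Hrho : 0 <= rho) by apply Cmod_ge_0.
apply Rnot_lt_le. intros Hlt.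
set (gap := c * f0 - 2 * eps * rho ^ 2 - X).
assert (Hgap : 0 < gap) by (unfold gap; lra).
set (t := Rmin (Rmin 1 (d / (2 * (rho + 1)))) (gap / (2 * (K * rho ^ 2 + 1)))).
assert (HKr : 0 <= K * rho ^ 2) by (apply Rmult_le_pos; [lra|apply pow_le; lra]).
assert (Ht : 0 < t).
{ apply Rmin_pos; [apply Rmin_pos; [lra|]|]; apply Rdiv_lt_0_compat; lra. }
assert (Ht1 : t <= 1).
{ unfold t. eapply Rle_trans; [apply Rmin_l|]. apply Rmin_l. }
assert (Htd : t * rho < d).
{ assert (Hm : t <= d / (2 * (rho + 1))).
  { unfold t. eapply Rle_trans; [apply Rmin_l|]. apply Rmin_r. }
  apply Rle_div_r in Hm; [|lra]. nra. }
assert (Htg : t * (K * rho ^ 2) < gap).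
{ assert (Hm : t <= gap / (2 * (K * rho ^ 2 + 1))) by apply Rmin_r.
  apply Rle_div_r in Hm; [|lra]. nra. }
set (z := (RtoC (1 - t) * z0)%C).
assert (Ezz : (z - z0 = - (t * z0))%C).
{ unfold z. rewrite RtoC_minus. ring. }
assert (Hzz : Cmod (z - z0) = t * rho).
{ rewrite Ezz, Cmod_opp, Cmod_mult, Cmod_R, Rabs_pos_eq; [reflexivity|lra]. }
assert (Hz : Cmod z = (1 - t) * rho).
{ unfold z. rewrite Cmod_mult, Cmod_R, Rabs_pos_eq; [reflexivity|lra]. }
specialize (HE z ltac:(lra)). rewrite Hzz in HE.
assert (Hm := Hmax z ltac:(rewrite Hz; nra)). rewrite Hz in Hm.
set (e := (F z - (F z0 + (z - z0) * B))%C) in HE.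
assert (Esum : (RtoC (1 + t * c) * F z0 = F z + (RtoC t * (c * F z0 + z0 * B) + - e))%C).
{ unfold e. rewrite Ezz, RtoC_plus, RtoC_mult. ring. }
assert (Hineq : (1 + t * c) * f0 <= Cmod (F z) + t * X + K * (t * rho) ^ 2).
{ unfold f0. rewrite <- (Rabs_pos_eq (1 + t * c)) by nra.
  rewrite <- Cmod_R, <- Cmod_mult, Esum.
  eapply Rle_trans; [apply Cmod_triangle|].
  generalize (Cmod_triangle (RtoC t * (c * F z0 + z0 * B)) (- e)).
  rewrite Cmod_opp, Cmod_mult, Cmod_R, Rabs_pos_eq by lra. fold X. lra. }
assert (Hcontra : t * gap <= t * (t * (K * rho ^ 2))).
{ unfold gap. assert (0 <= eps * t * (t * rho ^ 2)).
  { apply Rmult_le_pos; [nra|]. apply Rmult_le_pos; [lra|]. apply pow_le; lra. }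
  simpl in *. lra. }
apply Rmult_le_reg_l in Hcontra; [|exact Ht]. lra.
Qed.

(** * The reciprocal of a function in the class *)

Lemma power_series_factor n : forall (a : nat -> C) (f : C -> C), (1 <= n)%nat ->
  (forall k, (0 < k < n)%nat -> a k = RtoC 0) -> is_power_series a f ->
  exists b P, is_power_series b P /\
    forall z, in_unit_disk z -> f z = (a 0%nat + z ^ n * P z)%C.
Proof.
induction n as [|n IH]; intros a f Hn Ha Hf; [lia|].
destruct (power_series_shift a f Hf) as [g [Hg E]].
destruct (Nat.eq_dec n 0) as [->|Hn0].
- exists (fun k => a (S k)), g. split; [exact Hg|].
  intros z Hz. rewrite (E z Hz). ring.
- destruct (IH (fun k => a (S k)) g) as [b [P [HP EP]]]; [lia| |exact Hg|].
  { intros k Hk. apply Ha. lia. }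
  exists b, P. split; [exact HP|]. intros z Hz.
  rewrite (E z Hz), (EP z Hz), (Ha 1%nat), Cpow_S by lia. ring.
Qed.

(** [C] carries two convertible norms but two different uniform structures as a normed
    module over itself; the product rule is stated for one and [C_derive] for the other. *)
Lemma is_derive_C_AbsRing (f : C -> C) (z0 df : C) :
  is_derive (K := C_AbsRing) (V := AbsRing_NormedModule C_AbsRing) f z0 df <->
  is_derive (K := C_AbsRing) (V := C_NormedModule) f z0 df.
Proof.
split; intros [[L1 L2 L3] H]; (split; [constructor; [exact L1|exact L2|exact L3]|exact H]).
Qed.
Lemma is_derive_Cmult (f g : C -> C) (z0 df dg : C) :
  is_derive (K := C_AbsRing) (V := C_NormedModule) f z0 df ->
  is_derive (K := C_AbsRing) (V := C_NormedModule) g z0 dg ->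
  is_derive (K := C_AbsRing) (V := C_NormedModule) (fun z => f z * g z)%C z0
    (df * g z0 + f z0 * dg)%C.
Proof.
intros Hf Hg. apply is_derive_C_AbsRing in Hf, Hg. apply is_derive_C_AbsRing.
exact (is_derive_mult (K := C_AbsRing) f g z0 df dg Hf Hg Cmult_comm).
Qed.

(** Multiplying the derivative by [z0] avoids the exponent [n - 1]. *)
Lemma is_derive_Cpow n (z0 : C) :
  exists d, is_derive (K := C_AbsRing) (V := C_NormedModule) (fun z => z ^ n)%C z0 d /\
    (z0 * d = INR n * z0 ^ n)%C.
Proof.
induction n as [|n [d [Hd E]]].
- exists (RtoC 0). split; [|simpl; ring].
  exact (is_derive_const (K := C_AbsRing) (V := C_NormedModule) (RtoC 1) z0).
- exists (1 * z0 ^ n + z0 * d)%C. split.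
  + apply (is_derive_Cmult (fun z => z) (fun z => z ^ n)%C z0 1%C d); [|exact Hd].
    apply is_derive_C_AbsRing. exact (is_derive_id (K := C_AbsRing) z0).
  + rewrite Cmult_plus_distr_l, E, S_INR, RtoC_plus, !Cpow_S. ring.
Qed.

(** The product rule for [p (1 + z^n F) = 1] reads
    [p' / p = - p (z^n F)'], and [p - 1 = - p z^n F]. *)
Lemma log_derivative_of_reciprocal n p F z0 p' B :
  near z0 (fun z => p z * (1 + z ^ n * F z) = 1)%C ->
  is_derive (K := C_AbsRing) (V := C_NormedModule) p z0 p' ->
  is_derive (K := C_AbsRing) (V := C_NormedModule) F z0 B ->
  (p z0 + z0 * p' / p z0 - 1 = - (p z0 * (z0 ^ n * ((INR n + 1) * F z0 + z0 * B))))%C.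
Proof.
intros Hn Hp HF.
destruct (is_derive_Cpow n z0) as [d [Hd E]].
assert (H := is_derive_Cmult _ _ z0 _ _ Hd HF).
assert (H1 := is_derive_plus (K := C_AbsRing) (V := C_NormedModule) _ _ _ _ _
  (is_derive_const (K := C_AbsRing) (V := C_NormedModule) (RtoC 1) z0) H).
assert (H2 := is_derive_Cmult _ _ z0 _ _ Hp H1).
assert (H3 : is_derive (K := C_AbsRing) (V := C_NormedModule)
  (fun z => p z * (1 + z ^ n * F z))%C z0 (RtoC 0)).
{ destruct Hn as [e [He Hn]].
  apply (is_derive_ext_loc (K := C_AbsRing) (V := C_NormedModule) (fun _ => RtoC 1)).
  - exists (mkposreal e He). intros y Hy. symmetry. apply Hn. exact Hy.
  - exact (is_derive_const (K := C_AbsRing) (V := C_NormedModule) (RtoC 1) z0). }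
apply is_C_derive_unique in H3.
assert (H4 := is_C_derive_unique _ _ _ H2).
apply near_here in Hn.
assert (Hp0 : p z0 <> 0%C).
{ intros E0. rewrite E0 in Hn. apply C1_nz. rewrite <- Hn. ring. }
assert (E2 : (p' * (1 + z0 ^ n * F z0) + p z0 * (d * F z0 + z0 ^ n * B) = 0)%C).
{ rewrite <- H3. symmetry. etransitivity; [exact H4|].
  change ((p' * (1 + z0 ^ n * F z0) + p z0 * (0 + (d * F z0 + z0 ^ n * B)))%C
    = (p' * (1 + z0 ^ n * F z0) + p z0 * (d * F z0 + z0 ^ n * B))%C).
  ring. }
assert (Eq : (1 + z0 ^ n * F z0 = / p z0)%C).
{ replace (1 + z0 ^ n * F z0)%C with ((p z0 * (1 + z0 ^ n * F z0)) * / p z0)%C by (field; exact Hp0).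
  rewrite Hn. ring. }
rewrite Eq in E2.
assert (Ep : (p z0 - 1 = - (p z0 * (z0 ^ n * F z0)))%C).
{ transitivity (p z0 - p z0 * (1 + z0 ^ n * F z0))%C; [now rewrite Hn|ring]. }
transitivity (p z0 - 1 + (z0 * (p' * / p z0 + p z0 * (d * F z0 + z0 ^ n * B))
  - p z0 * (z0 * d * F z0 + z0 * z0 ^ n * B)))%C; [field; exact Hp0|].
rewrite Ep, E2, E. ring.
Qed.

(** With [s = sin |alpha|], squaring the hypothesis gives
    [1 + s^2 |w|^2 < 2 Re w]; the left side is at least [2 s |w|], so [cos (Arg w) > s]. *)
Lemma Arg_lt_of_close_to_1 (w : C) alpha :
  - (PI / 2) < alpha < PI / 2 -> w <> 0%C ->
  Cmod (1 - w) < cos alpha * Cmod w ->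
  Rabs (Arg w) < PI / 2 - Rabs alpha.
Proof.
intros Ha Hw H.
assert (Hm : 0 < Cmod w) by now apply Cmod_gt_0.
set (a := Rabs alpha).
assert (Ha0 : 0 <= a < PI / 2).
{ split; [apply Rabs_pos|]. unfold a. apply Rabs_def1; lra. }
assert (Ec : cos alpha = cos a).
{ unfold a, Rabs. destruct Rcase_abs; [now rewrite cos_neg|reflexivity]. }
rewrite Ec in H.
assert (Hc : 0 < cos a) by (apply cos_gt_0; lra).
assert (Hs : 0 <= sin a) by (apply sin_ge_0; lra).
assert (Hcs := sin2_cos2 a). unfold Rsqr in Hcs.
assert (E1 := Cmod2_alt (1 - w)). assert (E2 := Cmod2_alt w).
assert (Hsq : Cmod (1 - w) ^ 2 < (cos a * Cmod w) ^ 2).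
{ generalize (Cmod_ge_0 (1 - w)). simpl. nra. }
rewrite E1 in Hsq.
assert (Er : Re (1 - w) = 1 - Re w) by (destruct w; simpl; ring).
assert (Ei : Im (1 - w) = - Im w) by (destruct w; simpl; ring).
rewrite Er, Ei in Hsq.
assert (Hre : sin a * Cmod w < Re w).
{ assert (0 <= (1 - sin a * Cmod w) ^ 2) by apply pow2_ge_0.
  simpl in *.
  replace ((cos a * Cmod w) * ((cos a * Cmod w) * 1))
    with ((1 - sin a * sin a) * (Cmod w * (Cmod w * 1))) in Hsq
    by (replace (1 - sin a * sin a) with (cos a * cos a) by lra; ring).
  lra. }
set (x := Re w / Cmod w).
assert (Hx : sin a < x) by (apply Rlt_div_r; lra).
assert (Hx1 : x <= 1).
{ apply Rle_div_l; [lra|]. generalize (re_le_Cmod w) (Rle_abs (Re w)). lra. }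
assert (Hac : acos x < PI / 2 - a).
{ destruct (acos_bound x) as [Hb1 Hb2].
  apply Rnot_le_lt. intros Hle.
  assert (Hcc : cos (acos x) <= cos (PI / 2 - a)) by (apply cos_decr_1; lra).
  rewrite cos_acos, cos_shift in Hcc by lra. lra. }
destruct (acos_bound x) as [Hb1 _].
unfold Arg. fold x. destruct Rlt_dec; [rewrite Rabs_Ropp|]; rewrite Rabs_pos_eq; lra.
Qed.

(** * Jack's argument for the reciprocal *)

Lemma penalised_modulus_usc F eps z0 : 0 < eps -> expandable 1 z0 F ->
  forall eta, 0 < eta ->
  near z0 (fun z => Cmod (F z) + eps * Cmod z ^ 2 < Cmod (F z0) + eps * Cmod z0 ^ 2 + eta).
Proof.
intros Heps [g [[K HK] E]] eta Heta.
set (L := Rabs K + eps * (2 * Cmod z0 + 1) + 1).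
generalize (Cmod_ge_0 z0) (Rabs_pos K) (Rle_abs K); intros H0 HK0 HK1.
assert (HL : 0 < L).
{ unfold L. assert (0 <= eps * (2 * Cmod z0 + 1)) by (apply Rmult_le_pos; lra). lra. }
assert (Hd : 0 < Rmin 1 (eta / L)) by (apply Rmin_pos; [lra|now apply Rdiv_lt_0_compat]).
eapply near_mono; [|exact (near_and _ _ _ (near_and _ _ _ E HK) (near_ball z0 _ Hd))].
intros z [[Ez Hz] Hzd].
set (h := Cmod (z - z0)) in *. assert (Hh : 0 <= h) by apply Cmod_ge_0.
assert (Hh1 : h < 1) by (eapply Rlt_le_trans; [exact Hzd|apply Rmin_l]).
assert (HhL : h * L < eta).
{ apply Rlt_div_r; [lra|]. eapply Rlt_le_trans; [exact Hzd|apply Rmin_r]. }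
assert (H1 : Cmod (F z) <= Cmod (F z0) + h * Rabs K).
{ rewrite Ez. eapply Rle_trans; [apply Cmod_triangle|]. rewrite Cmod_mult. fold h.
  apply Rplus_le_compat_l. apply Rmult_le_compat_l; lra. }
assert (H2 : Cmod z <= Cmod z0 + h).
{ replace z with (z0 + (z - z0))%C at 1 by ring. apply Cmod_triangle. }
assert (H3 : Cmod z ^ 2 <= Cmod z0 ^ 2 + h * (2 * Cmod z0 + 1)).
{ generalize (Cmod_ge_0 z); intros. apply Rle_trans with ((Cmod z0 + h) ^ 2).
  - apply pow_incr; lra.
  - simpl. nra. }
apply (Rmult_le_compat_l eps) in H3; [|lra].
unfold L in HhL. nra.
Qed.

(** A point [z1] with [|z1^n F(z1)| >= c] gives, by maximising [|F| + (c/4) |z|^2] over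
    [|z| <= |z1|], a point [z0] of the same modulus with [|F(z0)| >= |F(z1)|], at which the
    differential inequality fails. *)
Lemma modulus_bound_of_differential_inequality n c p :
  (1 <= n)%nat -> 0 < c ->
  (exists a, a 0%nat = RtoC 1 /\ (forall k, (0 < k < n)%nat -> a k = RtoC 0) /\
     is_power_series a p) ->
  (forall z, in_unit_disk z -> p z <> RtoC 0) ->
  (forall z, in_unit_disk z ->
     Cmod (p z + z * C_derive p z / p z - 1)%C < (INR n / 2 + 1) * Cmod (p z) * c) ->
  forall z, in_unit_disk z -> Cmod (1 - p z) < c * Cmod (p z).
Proof.
intros Hn Hc [a [Ha0 [Ha Hp]]] Hp0 Hineq z1 Hz1.
apply Rnot_le_lt. intros Hge.
destruct (power_series_factor n a p Hn Ha Hp) as [b [P [HP EP]]]. rewrite Ha0 in EP.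
set (F := fun z => (- (1) * (P z * / p z))%C).
assert (HF : forall k z, in_unit_disk z -> expandable (S k) z F).
{ intros k z Hz. apply expandable_mult; [apply expandable_const|].
  apply expandable_mult; [now apply (power_series_expandable _ b)|].
  apply expandable_inv; [now apply (power_series_expandable _ a)|now apply Hp0]. }
assert (HpF : forall z, in_unit_disk z -> (p z * (1 + z ^ n * F z) = 1)%C).
{ intros z Hz. transitivity (p z - z ^ n * P z)%C.
  - unfold F. field. now apply Hp0.
  - rewrite (EP z Hz). ring. }
unfold in_unit_disk in Hz1. set (r := Cmod z1) in *.
assert (Hr0 : 0 <= r) by apply Cmod_ge_0.
assert (Hdisk : forall z, Cmod z <= r -> in_unit_disk z) by (unfold in_unit_disk; intros; lra).
assert (Hrn : 0 <= r ^ n <= 1).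
{ split; [apply pow_le; lra|]. rewrite <- (pow1 n). apply pow_incr; lra. }
assert (Hz1F : c <= r ^ n * Cmod (F z1)).
{ assert (E : (1 - p z1 = p z1 * (z1 ^ n * F z1))%C).
  { rewrite <- (HpF z1) at 1 by exact Hz1. ring. }
  rewrite E, !Cmod_mult, Cmod_pow in Hge. fold r in Hge.
  assert (Hm : 0 < Cmod (p z1)) by (apply Cmod_gt_0, Hp0; exact Hz1).
  apply (Rmult_le_reg_l (Cmod (p z1))); lra. }
assert (Heps : 0 < c / 4) by lra.
destruct (closed_disk_max (fun z => Cmod (F z) + c / 4 * Cmod z ^ 2) r Hr0) as [z0 [Hz0 Hmax]].
{ intros z Hz. apply penalised_modulus_usc; [exact Heps|]. now apply HF, Hdisk. }
assert (Hz0r : Cmod z0 = r).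
{ destruct (Rle_lt_or_eq_dec _ _ Hz0) as [Hlt|]; [exfalso|assumption].
  apply (no_local_max F (c / 4) z0 Heps); [now apply HF, Hdisk|].
  exists (r - Cmod z0). split; [lra|]. intros z Hz. apply Hmax.
  replace z with ((z - z0) + z0)%C by ring.
  generalize (Cmod_triangle (z - z0) z0). lra. }
destruct (expandable_linear_approx z0 F) as [B [K [HK HB]]]; [now apply HF, Hdisk|].
destruct (expandable_linear_approx z0 p) as [p' [L [HL Hp']]];
  [now apply (power_series_expandable _ a), Hdisk|].
assert (Hdp := linear_approx_is_derive p z0 p' L HL Hp').
assert (Hbd := radial_derivative_at_max F B K (c / 4) z0 (INR n + 1)
  ltac:(generalize (pos_INR n); lra) Heps HK HB).
specialize (Hbd ltac:(intros z Hz; apply Hmax; lra)). rewrite Hz0r in Hbd.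
assert (Hz0F : Cmod (F z1) <= Cmod (F z0)).
{ generalize (Hmax z1 (Rle_refl r)). rewrite Hz0r. fold r. lra. }
assert (Hz0d := Hdisk z0 Hz0).
specialize (Hineq z0 Hz0d).
rewrite (is_C_derive_unique _ _ _ Hdp) in Hineq.
rewrite (log_derivative_of_reciprocal n p F z0 p' B) in Hineq.
2: { exact (near_mono _ _ _ HpF (near_unit_disk z0 Hz0d)). }
2: { exact Hdp. }
2: { exact (linear_approx_is_derive F z0 B K HK HB). }
rewrite Cmod_opp, !Cmod_mult, Cmod_pow, Hz0r in Hineq.
assert (Hm : 0 < Cmod (p z0)) by (apply Cmod_gt_0, Hp0; exact Hz0d).
replace ((INR n / 2 + 1) * Cmod (p z0) * c)
  with (Cmod (p z0) * ((INR n / 2 + 1) * c)) in Hineq by ring.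
apply Rmult_lt_reg_l in Hineq; [|exact Hm].
rewrite RtoC_plus in Hbd.
apply (Rmult_le_compat_l (r ^ n)) in Hbd; [|lra].
assert (Hn1 : 1 <= INR n) by (apply (le_INR 1); exact Hn).
assert (Hr2 : r ^ n * r ^ 2 <= 1).
{ rewrite <- (Rmult_1_r 1). apply Rmult_le_compat; [lra|apply pow_le; lra|lra|].
  rewrite <- (pow1 2). apply pow_incr; lra. }
assert (H1 : c <= r ^ n * Cmod (F z0)).
{ eapply Rle_trans; [exact Hz1F|]. apply Rmult_le_compat_l; lra. }
apply (Rmult_le_compat_l (INR n + 1)) in H1; [|lra].
apply (Rmult_le_compat_l (c / 2)) in Hr2; [|lra].
apply (Rmult_le_compat_l c) in Hn1; [|lra].
lra.
Qed.

Theorem theorem3 :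
  forall (n : nat) (alpha : R) (p : C -> C),
    (1 <= n)%nat ->
    - (PI / 2) < alpha < PI / 2 ->
    class_H (RtoC 1) n p ->
    (forall z : C, in_unit_disk z -> p z <> RtoC 0) ->
    ~ (forall z : C, in_unit_disk z -> p z = RtoC 1) ->
    (forall z : C, in_unit_disk z ->
       Cmod (p z + z * C_derive p z / p z - RtoC 1)%C
         < (INR n / 2 + 1) * Cmod (p z) * cos alpha) ->
    forall z : C, in_unit_disk z ->
      Rabs (Arg (p z)) < PI / 2 - Rabs alpha.
Proof.
intros n alpha p Hn Hal [_ [a [Ha0 [Ha Hp]]]] Hp0 _ Hineq z Hz.
apply Arg_lt_of_close_to_1; [exact Hal|now apply Hp0|].
apply (modulus_bound_of_differential_inequality n (cos alpha) p); try assumption.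
- apply cos_gt_0; lra.
- exists a. split; [exact Ha0|]. split; [exact Ha|].
  intros w Hw. apply is_pseries_has_sum, Hp, Hw.
Qed.
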